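(* For every natural number $n \geq 1$, setting $m = 10^{5n}$, we have $\mathbb{E}^n \not\longrightarrow (\ell_2, \ell_m)$; that is, there exists a red/blue-coloring of $\mathbb{E}^n$ which contains no two red points at distance exactly one and no blue isometric copy of $\ell_m$.
   Context: $\mathbb{E}^n$ denotes $\mathbb{R}^n$ with the Euclidean distance. A red/blue-coloring of $\mathbb{E}^n$ is an arbitrary assignment of one of the two colors to each point. $\ell_m$ denotes a sequence of $m$ points on a line with consecutive points at distance one (i.e. an isometric copy of $\{0,1,\dots,m-1\} \subset \mathbb{R}$), so $\ell_2$ is a pair of points at distance one. A copy of a set means an isometric copy; it is red (blue) if all its points are red (blue). $\mathbb{E}^n \not\longrightarrow (\ell_2,K)$ means that some red/blue-coloring of $\mathbb{E}^n$ contains neither a red copy of $\ell_2$ nor a blue copy of $K$. *)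

(* Defs.v *)
From mathcomp Require Import all_boot all_order all_algebra.
From mathcomp Require Import classical_sets reals.

Set Implicit Arguments.
Unset Strict Implicit.
Unset Printing Implicit Defensive.

Local Open Scope classical_set_scope.
Local Open Scope ring_scope.

(* E^n is 'rV[R]_n equipped with this distance.  The norm that MathComp-Analysis
   puts on matrices is the sup norm, so the Euclidean distance is spelled out. *)
Definition edist (R : realType) (n : nat) (x y : 'rV[R]_n) : R :=
  Num.sqrt (\sum_(i < n) (x ord0 i - y ord0 i) ^+ 2).

(* The dimensions d and n may differ: a configuration is drawn in any E^d, and
   its copies are looked for in E^n.  Only distances between points of K are
   constrained. *)
Definition isometric_copy (R : realType) (d n : nat)
    (K : set 'rV[R]_d) (A : set 'rV[R]_n) : Prop :=
  exists f : 'rV[R]_d -> 'rV[R]_n,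
    (forall x y, K x -> K y -> edist (f x) (f y) = edist x y) /\ A = f @` K.

(* The model {0, 1, ..., m-1} of l_m, with the line R taken to be E^1. *)
Definition ell (R : realType) (m : nat) : set 'rV[R]_1 :=
  [set x | exists2 k : nat, (k < m)%N & x = const_mx k%:R].
Arguments ell R m : clear implicits.

Inductive color : Type := Red | Blue.

Definition monochromatic (R : realType) (n : nat) (chi : 'rV[R]_n -> color)
    (c : color) (A : set 'rV[R]_n) : Prop :=
  forall x, A x -> chi x = c.

(* The relation written E^n -/-> (K1, K2). *)
Definition not_arrow (R : realType) (n d1 d2 : nat)
    (K1 : set 'rV[R]_d1) (K2 : set 'rV[R]_d2) : Prop :=
  exists chi : 'rV[R]_n -> color,
    ~ (exists A, isometric_copy K1 A /\ monochromatic chi Red A) /\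
    ~ (exists A, isometric_copy K2 A /\ monochromatic chi Blue A).
Arguments not_arrow {R} n {d1 d2} K1 K2.

(* Main.v *)
Require Import Defs.
From mathcomp Require Import all_boot all_order all_algebra.
From mathcomp Require Import classical_sets reals.
From mathcomp Require Import boolp.
From mathcomp Require Import zify ring lra.

(* Dilate the space by [7 sqrt n], so that distance 1 becomes [7 sqrt n], and
   colour red the points within [3 sqrt n] of a set [S] of lattice points.  If
   distinct points of [S] are more than [13 sqrt n] apart, no two red points are
   at unit distance.  A line of [5 t] points is replaced by [t] lattice points:
   keep every fifth point and round position and direction.  The rounding error
   lies in [[0, 3]^n], hence has norm at most [3 sqrt n], so it suffices that [S]
   meets all these discretized lines.  Take [S] periodic modulo [M = 100 t n]:
   there are then at most [M^(2n)] discretized lines.  Label the torus at random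
   with [2 d] labels, [d = 100^n] bounding the number of lattice points in a ball
   of radius [13 sqrt n], and select the points labelled 0 whose ball contains no
   other 0.  A point is selected with probability at least [1 / (4 d)],
   independently along a discretized line since the balls are disjoint, so the
   union bound [M^(2n) (1 - 1 / (4 d))^t < 1] yields a suitable [S]. *)

Set Implicit Arguments.
Unset Strict Implicit.
Unset Printing Implicit Defensive.

Import Order.TTheory GRing.Theory Num.Theory.

(** * Independent sets meeting every line *)

Lemma leq_card_bigcup (V I : finType) (D : pred I) (F : I -> {set V}) :
  #|\bigcup_(i | D i) F i| <= \sum_(i | D i) #|F i|.
Proof.
elim/big_rec2: _ => [|i c A _ le_cA]; first by rewrite cards0.
by rewrite (leq_trans (leq_card_setU _ _)) // leq_add2l.
Qed.

(* Exchanging the values of two labellings outside [A] is an involution of the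
   pairs; it turns the event [P /\ Q] on the first one into [P] on the first and
   [Q] on the second. *)
Lemma card_ffun_indep (V C : finType) (A : {set V}) (P Q : pred {ffun V -> C}) :
  (forall f g : {ffun V -> C}, {in A, f =1 g} -> P f = P g) ->
  (forall f g : {ffun V -> C}, {in ~: A, f =1 g} -> Q f = Q g) ->
  #|[set f | P f && Q f]| * #|{: {ffun V -> C}}| =
  #|[set f | P f]| * #|[set f | Q f]|.
Proof.
move=> PA QA.
pose mix (f g : {ffun V -> C}) := [ffun v => if v \in A then f v else g v].
pose swap (u : {ffun V -> C} * {ffun V -> C}) := (mix u.1 u.2, mix u.2 u.1).
have swapK : involutive swap.
  case=> f g; congr (_, _); apply/ffunP=> v; rewrite ffunE /=;
    by case: ifP => vA; rewrite ffunE vA.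
have Pmix f g : P (mix f g) = P f by apply: PA => v vA; rewrite ffunE vA.
have Qmix f g : Q (mix f g) = Q g.
  by apply: QA => v; rewrite ffunE inE => /negPf->.
rewrite -[#|{: _}|]cardsT -!cardsX.
rewrite -(card_imset _ (inv_inj swapK)); apply: eq_card => u.
rewrite -{1}[u]swapK (mem_imset _ _ (inv_inj swapK)) !inE /=.
by rewrite andbT Pmix Qmix.
Qed.

(** Adding [c] in the cyclic group ['I_k.+1] permutes the labellings and carries label 0 at [z] to
    label [c], so all labels are equally frequent at [z]. *)
Lemma card_ffun_at (V : finType) (k : nat) (z : V) :
  k.+1 * #|[set f : {ffun V -> 'I_k.+1} | f z == ord0]| =
  #|{: {ffun V -> 'I_k.+1}}|.
Proof.
have eq_c c : #|[set f : {ffun V -> 'I_k.+1} | f z == c]| =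
              #|[set f : {ffun V -> 'I_k.+1} | f z == ord0]|.
  pose shift (f : {ffun V -> 'I_k.+1}) := [ffun v => (f v + c)%R].
  have shift_inj : injective shift.
    move=> f g /ffunP fg; apply/ffunP=> v; move: (fg v); rewrite !ffunE.
    exact: GRing.addIr.
  rewrite -(card_imset [set f : {ffun V -> 'I_k.+1} | f z == ord0] shift_inj).
  apply: eq_card => f; pose g := [ffun v => (f v - c)%R].
  have -> : f = shift g by apply/ffunP=> v; rewrite !ffunE GRing.subrK.
  rewrite (mem_imset _ _ shift_inj) !inE !ffunE GRing.subrK.
  exact: esym (GRing.subr_eq0 _ _).
rewrite -[RHS]sum1_card (partition_big (fun f : {ffun V -> 'I_k.+1} => f z) predT) //=.
rewrite (eq_bigr (fun=> #|[set f : {ffun V -> 'I_k.+1} | f z == ord0]|)).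
  by rewrite sum_nat_const card_ord.
by move=> c _; rewrite -(eq_c c) -sum1_card; apply: eq_bigl => f; rewrite inE.
Qed.

Section RandomIndependentSet.

Variables (V : finType) (N : V -> {set V}) (k d : nat).
Hypotheses (d_gt0 : 0 < d) (kE : k.+1 = 2 * d).
Hypotheses (N_refl : forall z, z \in N z) (card_N : forall z, #|N z| <= d).

Definition selected (f : {ffun V -> 'I_k.+1}) (z : V) :=
  (f z == ord0) && [forall w in N z, (w != z) ==> (f w != ord0)].

Lemma selected_local z (f g : {ffun V -> 'I_k.+1}) :
  {in N z, f =1 g} -> selected f z = selected g z.
Proof.
move=> fg; rewrite /selected fg //; congr (_ && _).
by apply: eq_forallb_in => w /fg ->.
Qed.

(** Label 0 at [z] has probability [1 / (2 d)]; by a union bound over [N z], another 0 there has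
    probability at most [1 / 2]. The two events read disjoint sets of labels, hence are
    independent. *)
Lemma card_selected z :
  #|{: {ffun V -> 'I_k.+1}}| <= 4 * d * #|[set f | selected f z]|.
Proof.
set T := #|{: _}|.
have T_gt0 : 0 < T by apply/card_gt0P; exists [ffun=> ord0].
pose Q (f : {ffun V -> 'I_k.+1}) := [forall w in N z, (w != z) ==> (f w != ord0)].
have indep := @card_ffun_indep V _ [set z] (fun f => f z == ord0) Q.
have {}indep : #|[set f | selected f z]| * T =
    #|[set f : {ffun V -> 'I_k.+1} | f z == ord0]| * #|[set f | Q f]|.
  apply: indep => f g fg; first by rewrite fg // inE.
  apply: eq_forallb_in => w _; case: eqVneq => //= wz; rewrite fg //.
  by rewrite !inE.
have bad : 2 * #|[set f | ~~ Q f]| <= T.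
  have sub : [set f | ~~ Q f] \subset
      \bigcup_(w in N z) [set f : {ffun V -> 'I_k.+1} | f w == ord0].
    apply/fintype.subsetP=> f; rewrite inE => /forall_inPn[w wN].
    rewrite negb_imply negbK => /andP[_ fw].
    by apply/bigcupP; exists w; rewrite ?inE.
  have le1 : #|[set f | ~~ Q f]| <=
      \sum_(w in N z) #|[set f : {ffun V -> 'I_k.+1} | f w == ord0]|.
    exact: leq_trans (subset_leq_card sub) (leq_card_bigcup _ _).
  rewrite -(leq_pmul2l d_gt0) mulnA [d * 2]mulnC -kE.
  apply: leq_trans (leq_mul (leqnn _) le1) _; rewrite big_distrr /=.
  rewrite (eq_bigr (fun=> T)) => [|w _]; last exact: card_ffun_at.
  by rewrite sum_nat_const leq_mul2r card_N orbT.
have split : #|[set f | Q f]| + #|[set f | ~~ Q f]| = T.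
  rewrite -[RHS](cardsC [set f | Q f]); congr (_ + _).
  by apply: eq_card => f; rewrite !inE.
have := card_ffun_at k z; rewrite -/T [k.+1 * _](congr1 (muln^~ _) kE).
set z0 := #|_|; move: indep; rewrite -/z0; set q := #|[set f | Q f]|.
rewrite -(leq_pmul2r T_gt0) -[X in _ <= X]mulnA => -> zT.
rewrite (_ : 4 * d * (z0 * q) = 2 * d * z0 * (2 * q)); last by lia.
by rewrite zT leq_mul2l; apply/orP; right; lia.
Qed.

(** Selection at [z] reads only the labels on [N z], so misses at points with disjoint
    neighbourhoods are independent, each of probability at most [1 - 1 / (4 d)]. Denominators are
    cleared. *)
Lemma card_missed (s : seq V) :
  pairwise (fun z w => [disjoint N z & N w]) s ->
  #|[set f | all (fun z => ~~ selected f z) s]| * (4 * d) ^ size s <=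
  (4 * d - 1) ^ size s * #|{: {ffun V -> 'I_k.+1}}|.
Proof.
set T := #|{: _}|.
have T_gt0 : 0 < T by apply/card_gt0P; exists [ffun=> ord0].
elim: s => [|z s IHs] /=; first by rewrite mul1n muln1 max_card.
case/andP=> dis_z /IHs {}IHs.
have : #|[set f | ~~ selected f z && all (fun z => ~~ selected f z) s]| * T =
    #|[set f | ~~ selected f z]| * #|[set f | all (fun z => ~~ selected f z) s]|.
  apply: (@card_ffun_indep V _ (N z) (fun f => ~~ selected f z)
    (fun f => all (fun z => ~~ selected f z) s)) => f g fg.
    by rewrite (selected_local fg).
  apply: eq_in_all => w ws; congr (~~ _).
  apply: selected_local => v vN; apply: fg.
  rewrite inE; apply: contraL vN => vN.
  by rewrite (disjointFr (allP dis_z w ws) vN).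
move=> indep.
have split : #|[set f | selected f z]| + #|[set f | ~~ selected f z]| = T.
  rewrite -[RHS](cardsC [set f | selected f z]); congr (_ + _).
  by apply: eq_card => f; rewrite !inE.
have := card_selected z; rewrite -/T => sel.
rewrite !expnS -(leq_pmul2r T_gt0).
have {}sel : 4 * d * #|[set f | ~~ selected f z]| <= (4 * d - 1) * T.
  by rewrite mulnBl mul1n; nia.
apply: leq_trans (_ : (4 * d * #|[set f | ~~ selected f z]|) *
  (#|[set f | all (fun z => ~~ selected f z) s]| * (4 * d) ^ size s) <= _).
  by rewrite mulnAC indep; lia.
by apply: leq_trans (leq_mul sel IHs) _; lia.
Qed.

End RandomIndependentSet.

Lemma independent_hitting_set (V I : finType) (N : V -> {set V}) (d t : nat)
    (P : I -> 'I_t -> V) :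
  0 < d -> (forall z, z \in N z) -> (forall z, #|N z| <= d) ->
  #|I| * (4 * d - 1) ^ t < (4 * d) ^ t ->
  exists S : {set V},
    (forall z w, z \in S -> w \in S -> w \in N z -> z = w) /\
    (forall i, (forall l l' : 'I_t, l < l' -> [disjoint N (P i l) & N (P i l')]) ->
       exists l, P i l \in S).
Proof.
move=> d_gt0 N_refl card_N few.
have [k kE] : exists k, k.+1 = 2 * d by exists (2 * d).-1; rewrite prednK // muln_gt0.
pose ps i := [seq P i l | l <- enum 'I_t].
pose good i := pairwise (fun z w => [disjoint N z & N w]) (ps i).
pose missed f i := all (fun z => ~~ selected (k := k) N f z) (ps i).
have size_ps i : size (ps i) = t by rewrite size_map size_enum_ord.
have [f hit] : exists f, [forall i, good i ==> ~~ missed f i].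
  (* If every labelling missed some good [i], summing [card_missed] over the good [i] would
     contradict [few]. *)
  apply/existsP; apply: contraLR few; rewrite negb_exists => /forallP all_bad.
  set T := #|{: {ffun V -> 'I_k.+1}}|.
  have T_gt0 : 0 < T by apply/card_gt0P; exists [ffun=> ord0].
  rewrite -leqNgt -(leq_pmul2r T_gt0) -mulnA.
  have le_T : T <= \sum_(i | good i) #|[set f | missed f i]|.
    rewrite -{1}[T]cardsT; apply: leq_trans (leq_card_bigcup _ _).
    apply/subset_leq_card/fintype.subsetP=> f _; move: (all_bad f).
    rewrite negb_forall => /existsP[i]; rewrite negb_imply negbK => /andP[gi mi].
    by apply/bigcupP; exists i; rewrite ?inE.
  rewrite mulnC; apply: leq_trans (leq_mul le_T (leqnn _)) _.
  rewrite big_distrl /=.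
  apply: leq_trans (_ : \sum_(i | good i) ((4 * d - 1) ^ t * T) <= _).
    apply: leq_sum => i gi; rewrite -{1 2}(size_ps i).
    exact: (card_missed d_gt0 kE N_refl card_N gi).
  by rewrite sum_nat_const leq_mul2r max_card orbT.
exists [set z | selected N f z]; split=> [z w|i dis].
  rewrite !inE => /andP[_ /forall_inP zN] /andP[/eqP w0 _] /zN.
  by rewrite w0 eqxx implybF negbK => /eqP.
have gi : good i.
  rewrite /good /ps pairwise_map.
  apply: (@sub_pairwise _ (relpre (@nat_of_ord t) ltn)) => [l l' /=|]; first exact: dis.
  rewrite -pairwise_map val_enum_ord -sorted_pairwise; last exact: ltn_trans.
  exact: iota_ltn_sorted.
move: (forallP hit i); rewrite gi /= => /allPn[z /mapP[l _ ->]].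
by rewrite negbK => sel; exists l; rewrite inE.
Qed.

(** * Counting lattice points and discretized lines *)

(** The first two terms of the binomial expansion of [((k - 1) + 1) ^ k] already add up to at least
    [2 * (k - 1) ^ k]. *)
Lemma double_predn_expn (k : nat) : 0 < k -> 2 * (k - 1) ^ k <= k ^ k.
Proof.
case: k => // k _; rewrite subSS subn0.
have -> : k.+1 ^ k.+1 = (k + 1) ^ k.+1 by rewrite addn1.
rewrite expnDn 2!big_ord_recl /= bin0 bin1 !subn0 !exp1n !muln1 !mul1n expnS.
by rewrite /bump /= !addn0 subn1 /=; nia.
Qed.

(** Since [t = 4 d g], the bound [(1 - 1 / (4 d)) ^ (4 d) <= 1 / 2] applies [g] times. The number of
    lines has logarithm at most quadratic in [p], while [g] grows like [1000 ^ p]. *)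
Lemma few_discrete_lines (p t d M : nat) :
  t = 2 * 10 ^ (5 * p + 4) -> d = 100 ^ p.+1 -> M = 100 * t * p.+1 ->
  (M * M) ^ p.+1 * (4 * d - 1) ^ t < (4 * d) ^ t.
Proof.
move=> tE dE ME.
pose g := 50 * 1000 ^ p.
have d_gt0 : 0 < d by rewrite dE expn_gt0.
have tg : t = 4 * d * g.
  rewrite tE dE /g expnS expnD expnM.
  have -> : 10 ^ 4 = 100 * 100 by rewrite (expnM 10 2 2).
  have -> : 10 ^ 5 = 100 * 1000 by rewrite (expnD 10 2 3).
  by rewrite expnMn; lia.
have p2 : p.+1 <= 2 ^ p by rewrite ltn_expl.
have le_exp2r a b e : a <= b -> a ^ e <= b ^ e.
  by case: e => // e ab; rewrite leq_exp2r.
(* From [200 <= 2 ^ 8], [10 ^ 5 <= 2 ^ 17], [10 ^ 4 <= 2 ^ 14] and [p2]. *)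
have leM : M <= 2 ^ (22 + 18 * p).
  have e10 : 10 ^ (5 * p + 4) <= 2 ^ (17 * p + 14).
    rewrite (expnD 10) (expnD 2) (expnM 10 5) (expnM 2 17); apply: leq_mul.
      by apply: le_exp2r; rewrite (expnD 10 2 3) (expnD 2 7 10); apply: leq_mul.
    by rewrite (expnM 10 2 2) (expnM 2 7 2); apply: le_exp2r.
  rewrite ME tE (mulnA 100 2) (_ : 22 + 18 * p = 8 + (17 * p + 14) + p); last by lia.
  by rewrite 2!(expnD 2); apply: leq_mul p2; apply: leq_mul.
have leMM : (M * M) ^ p.+1 < 2 ^ g.
  apply: leq_ltn_trans (_ : 2 ^ ((44 + 36 * p) * p.+1) < _).
    rewrite expnM le_exp2r // (_ : 44 + _ = (22 + 18 * p) + (22 + 18 * p)).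
      by rewrite expnD leq_mul.
    by lia.
  rewrite ltn_exp2l // /g.
  have -> : 1000 ^ p = 250 ^ p * (2 ^ p * 2 ^ p) by rewrite -!expnMn.
  have : 0 < 250 ^ p by rewrite expn_gt0.
  have : 44 + 36 * p <= 44 * 2 ^ p by lia.
  nia.
have pos : 0 < (4 * d - 1) ^ t by rewrite expn_gt0; lia.
apply: leq_trans (_ : 2 ^ g * (4 * d - 1) ^ t <= _); first by rewrite ltn_pmul2r.
rewrite tg !(expnM _ _ g) -expnMn le_exp2r // double_predn_expn //; lia.
Qed.

Lemma card_lattice_ball (n K : nat) :
  #|[set c : {ffun 'I_n -> bool * 'I_K} | \sum_j (c j).2 ^ 2 <= 169 * n]|
    <= 100 ^ n.
Proof.
set C := [set c | _].
(* By [26 a <= a ^ 2 + 169] the l1 norm is at most 13 n on the ball, so the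
   geometric weight of the l1 norm is at least [q ^ (13 n)] there. *)
have [q qE] : exists q : rat, q = (9 / 10)%R by exists (9 / 10)%R.
have q_ge0 : (0 <= q)%R by rewrite qE; lra.
have q_le1 : (q <= 1)%R by rewrite qE; lra.
pose wt (c : {ffun 'I_n -> bool * 'I_K}) : rat := (\prod_j q ^+ (c j).2)%R.
have wt_ge0 c : (0 <= wt c)%R by apply: prodr_ge0 => j _; apply: exprn_ge0.
(* Each coordinate contributes two signs times a geometric series, at most [2 / (1 - q) = 20]. *)
have total : (\sum_c wt c <= 20%:R ^+ n)%R.
  rewrite /wt -(bigA_distr_bigA (fun j (a : bool * 'I_K) => q ^+ a.2)%R).
  rewrite prodr_const card_ord lerXn2r // ?nnegrE ?sumr_ge0 // => [*|].
    exact: exprn_ge0.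
  rewrite -(pair_big predT predT (fun (s : bool) (a : 'I_K) => q ^+ a)%R) /=.
  rewrite big_const card_bool /= addr0.
  have := subrX1 q K; have : (0 <= q ^+ K)%R by apply: exprn_ge0.
  set S := (\sum_i _)%R; set Q := (q ^+ K)%R; rewrite qE; lra.
have heavy c : c \in C -> (q ^+ (13 * n) <= wt c)%R.
  rewrite inE => cC; rewrite /wt prodrXr ler_wiXn2l // ?q_ge0 ?q_le1 //.
  rewrite -(leq_pmul2l (isT : 0 < 26)).
  have : \sum_j 26 * (c j).2 <= \sum_j ((c j).2 ^ 2 + 169).
    by apply: leq_sum => j _; rewrite -mulnn; case: (leqP (c j).2 13); nia.
  rewrite -big_distrr big_split /= sum_nat_const card_ord => le26.
  by apply: leq_trans le26 _; rewrite mulnA -[26 * 13]/(169 + 169) mulnDl [n * 169]mulnC leq_add2r.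
have : (#|C|%:R * q ^+ (13 * n) <= 20%:R ^+ n :> rat)%R.
  apply: le_trans total; rewrite (bigID (mem C)) /= ler_wpDr ?sumr_ge0 //.
  by rewrite mulr_natl -sumr_const ler_sum.
move=> le20; rewrite -(ler_nat rat) natrX.
(* Dividing by the weight costs a factor 5 per coordinate, whence [20 * 5 = 100]. *)
have q13 : (1 / 5 <= q ^+ 13 :> rat)%R by rewrite qE !exprS expr0; lra.
have -> : (100%:R = 20%:R * 5%:R :> rat)%R by lra.
rewrite exprMn; apply: le_trans (ler_wpM2r _ le20); last exact: exprn_ge0.
rewrite -mulrA exprM -exprMn ler_peMr // exprn_ege1 //; lra.
Qed.

Local Open Scope ring_scope.

(** * A sparse periodic lattice set *)

Lemma intr_Zp_eq0 (M : nat) (x : int) :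
  (1 < M)%N -> (`|x| < M)%N -> x%:~R = 0 :> 'Z_M -> x = 0.
Proof.
move=> M1 xM.
have small k : (k < M)%N -> k%:R = 0 :> 'Z_M -> k = 0%N.
  by move=> kM /(congr1 val); rewrite /= val_Zp_nat // modn_small.
case: x xM => k /= kM; first by move/small => ->.
by rewrite NegzE mulrNz => /eqP; rewrite oppr_eq0 => /eqP/small => /(_ kM).
Qed.

Definition sqnorm (n : nat) (z : 'I_n -> int) : int := \sum_j z j ^+ 2.

Lemma sqnormE (n : nat) (z : 'I_n -> int) :
  sqnorm z = (\sum_j `|z j| ^ 2)%N%:Z.
Proof.
rewrite /sqnorm (big_morph Posz PoszD (erefl 0)); apply: eq_bigr => j _.
by lia.
Qed.

(** Parallelogram law, with the nonnegative squared norm of the sum dropped. *)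
Lemma le_sqnormB (n : nat) (z w : 'I_n -> int) (r : int) :
  sqnorm z <= r -> sqnorm w <= r -> sqnorm (fun j => z j - w j) <= 4 * r.
Proof.
move=> zr wr; apply: le_trans (_ : 2 * sqnorm z + 2 * sqnorm w <= _); last by lia.
rewrite /sqnorm !mulr_sumr -big_split /=; apply: ler_sum => j _.
have := sqr_ge0 (z j + w j); rewrite sqrrD sqrrB; lia.
Qed.

Lemma abs_divz_le (b : int) (l t B : nat) :
  (l < t)%N -> (`|b| <= B)%N -> (`|(l%:Z * b %/ t)%Z| <= B)%N.
Proof.
move=> lt_lt bB; have := divz_eq (l%:Z * b) t.
have := modz_ge0 (l%:Z * b) (d := t); have := ltz_pmod (l%:Z * b) (d := t).
move: (_ %/ _)%Z (_ %% _)%Z => x r r_lt r_ge e.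
have {}r_lt : r < t by apply: r_lt; lia.
have {}r_ge : 0 <= r by apply: r_ge; lia.
have : (- B%:Z <= b <= B%:Z) by lia.
case/andP=> bl bu.
have h1 : l%:Z * b <= l%:Z * B%:Z by nia.
have h2 : - (l%:Z * B%:Z) <= l%:Z * b by nia.
have h3 : l%:Z * B%:Z <= (t%:Z - 1) * B%:Z by nia.
have u : x <= B%:Z by nia.
have v : - B%:Z <= x by nia.
lia.
Qed.

Lemma abs_le_ball (n : nat) (z : 'I_n -> int) j : sqnorm z <= (169 * n)%:Z -> (`|z j| <= 13 * n)%N.
Proof.
move=> zn; move: zn; rewrite sqnormE lez_nat (bigD1 j) //= => zn.
have {zn} : (`|z j| ^ 2 <= 169 * n)%N by apply: leq_trans zn; apply: leq_addr.
have := leq_pmulr n (n := n); nia.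
Qed.

Lemma eq_addr_subr (V : zmodType) (x y y' u u' : V) :
  x + y + u = x + y' + u' -> y' - y = u - u'.
Proof.
rewrite -!addrA => /addrI h; apply/eqP.
by rewrite subr_eq addrAC eq_sym subr_eq addrC h.
Qed.

Section LatticeBall.

Variables (n M : nat).
Hypothesis (M1 : (1 < M)%N).

Definition torus_mod (z : 'I_n -> int) : {ffun 'I_n -> 'Z_M} := [ffun j => (z j)%:~R].

(** Taking the image of the lattice ball of radius [13 sqrt n] avoids choosing representatives
    modulo [M]. *)
Definition torus_ball (v : {ffun 'I_n -> 'Z_M}) : {set {ffun 'I_n -> 'Z_M}} :=
  [set w | `[< exists2 z : 'I_n -> int, sqnorm z <= (169 * n)%:Z
                                       & w = v + torus_mod z >]].

Lemma torus_ballP v w :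
  reflect (exists2 z : 'I_n -> int, sqnorm z <= (169 * n)%:Z & w = v + torus_mod z)
    (w \in torus_ball v).
Proof. by rewrite inE; apply: asboolP. Qed.

Lemma mem_torus_ball v : v \in torus_ball v.
Proof.
apply/torus_ballP; exists (fun=> 0); first by rewrite /sqnorm big1.
by apply/ffunP=> j; rewrite !ffunE addr0.
Qed.

Lemma card_torus_ball v : (#|torus_ball v| <= 100 ^ n)%N.
Proof.
pose K := (13 * n).+1.
(* Coordinates are coded by sign and absolute value; reduction modulo [M] can only merge points, so
   the lattice count bounds the torus count. *)
pose dec (c : {ffun 'I_n -> bool * 'I_K}) : {ffun 'I_n -> 'Z_M} :=
  v + torus_mod (fun j => (-1) ^+ (c j).1 * ((c j).2 : nat)%:Z).
apply: leq_trans (card_lattice_ball n K).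
apply: leq_trans (leq_imset_card dec _).
apply/subset_leq_card/fintype.subsetP => w /torus_ballP[z zn ->].
apply/imsetP; exists [ffun j => (z j < 0, inord `|z j|%N)].
  move: (zn); rewrite inE sqnormE lez_nat; apply: leq_trans.
  by apply: leq_sum => j _; rewrite ffunE inordK // ltnS abs_le_ball.
congr (_ + _); apply/ffunP=> j; rewrite !ffunE inordK ?ltnS ?abs_le_ball //=.
by rewrite -intEsign.
Qed.

Lemma torus_mod_inj (z w : 'I_n -> int) :
  (forall j, `|z j - w j| < M)%N -> torus_mod z = torus_mod w -> z = w.
Proof.
move=> zw /ffunP eq_zw; apply/funext => j; apply/eqP; rewrite -subr_eq0; apply/eqP.
apply: (intr_Zp_eq0 M1 (zw j)).
by rewrite rmorphB /= -[RHS](subrr (z j)%:~R); move: (eq_zw j); rewrite !ffunE => ->.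
Qed.

End LatticeBall.

(** [S] is the preimage of a hitting set in the torus. A discretized line is coded by [a] modulo [M]
    and by [b], shifted by [35 t n] into the naturals below [M]: [M * M] choices per coordinate. *)
Lemma sparse_lattice_set (p t : nat) (n := p.+1) :
  t = (2 * 10 ^ (5 * p + 4))%N ->
  exists S : ('I_n -> int) -> Prop,
    (forall z w, S z -> S w -> sqnorm (fun j => w j - z j) <= (169 * n)%:Z -> z = w) /\
    (forall a b : 'I_n -> int, (forall j, `|b j| <= 35 * t * n)%N ->
       (forall l l' : 'I_t, (l < l')%N ->
          (676 * n)%:Z < sqnorm (fun j => (l'%:Z * b j %/ t)%Z - (l%:Z * b j %/ t)%Z)) ->
       exists l : 'I_t, S (fun j => a j + (l%:Z * b j %/ t)%Z)).
Proof.
(* [M] exceeds [70 t n + 26 n], so the integer vectors compared below are equal once they are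
   congruent modulo [M]. *)
move=> tE; pose M := (100 * t * n)%N.
have t_gt0 : (0 < t)%N by rewrite tE muln_gt0 expn_gt0.
have M1 : (1 < M)%N by rewrite /M /n; nia.
have M13 : (13 * n < M)%N by rewrite /M /n; nia.
pose I := {ffun 'I_n -> 'Z_M * 'I_M}.
pose step (b : int) (l : nat) := (l%:Z * b %/ t)%Z.
pose P (i : I) (l : 'I_t) : {ffun 'I_n -> 'Z_M} :=
  [ffun j => (i j).1 + (step ((i j).2%:Z - (35 * t * n)%:Z) l)%:~R].
have cardI : #|I| = ((M * M) ^ n)%N.
  by rewrite card_ffun card_prod !card_ord Zp_cast.
have [|v|v||S [indep hit]] := @independent_hitting_set _ _ (@torus_ball n M) (100 ^ n) t P.
- by rewrite expn_gt0.
- exact: mem_torus_ball.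
- exact: card_torus_ball.
- by rewrite cardI; apply: few_discrete_lines.
exists (fun z => torus_mod M z \in S); split=> [z w zS wS zw|a b bn sep].
  apply: (@torus_mod_inj _ M) => // [j|].
    rewrite distnC; apply: leq_ltn_trans M13.
    by have := abs_le_ball j zw.
  apply: indep => //; apply/torus_ballP; exists (fun j => w j - z j) => //.
  by apply/ffunP=> j; rewrite !ffunE -rmorphD /= addrC subrK.
have b_lt j : (absz (b j + (35 * t * n)%:Z)%R < M)%N by have := bn j; rewrite /M; lia.
pose i : I := [ffun j => ((a j)%:~R, Ordinal (b_lt j))].
have PE l : P i l = torus_mod M (fun j => a j + step (b j) l).
  apply/ffunP=> j; rewrite !ffunE /= rmorphD /=; congr (_ + (step _ _)%:~R).
  by have := bn j; lia.
have [l l' ll'|l] := hit i; last by rewrite PE => lS; exists l.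
(* If two balls met, the displacement between their centres would be a difference of two vectors of
   norm at most [13 sqrt n], of squared norm at most [4 * 169 n = 676 n]. *)
rewrite disjoint_subset; apply/fintype.subsetP=> v /torus_ballP[d dn ->]; rewrite inE.
apply/negP=> /torus_ballP[d' d'n].
rewrite !PE => eq_v; have := sep _ _ ll'.
have step_le j (k : 'I_t) : (`|step (b j) k| <= 35 * t * n)%N.
  exact: abs_divz_le.
have -> : (fun j => step (b j) l' - step (b j) l) = (fun j => d j - d' j).
  apply: (@torus_mod_inj _ M) => // [j|].
    have := step_le j l; have := step_le j l'; have := abs_le_ball j dn.
    have := abs_le_ball j d'n; rewrite /M; nia.
  move/ffunP: eq_v => eq_v; apply/ffunP=> j; move: (eq_v j); rewrite !ffunE.
  rewrite !rmorphB /= !rmorphD /= => e.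
  exact: eq_addr_subr e.
by have := le_sqnormB dn d'n; lia.
Qed.

(** * Lines in Euclidean space *)

(* Weighted AM-GM, [ab (x + y)^2 <= (a + b) (b x^2 + a y^2)], replaces Cauchy-Schwarz. *)
Lemma sum_sqrD_le (R : realFieldType) (I : finType) (x y : I -> R) (a b N : R) :
  0 < a -> 0 < b -> \sum_i x i ^+ 2 <= a ^+ 2 * N -> \sum_i y i ^+ 2 <= b ^+ 2 * N ->
  \sum_i (x i + y i) ^+ 2 <= (a + b) ^+ 2 * N.
Proof.
move=> a_gt0 b_gt0 xa yb.
have ab_gt0 : 0 < a * b by apply: mulr_gt0.
have abD_gt0 : 0 < a + b by apply: addr_gt0.
rewrite -(ler_pM2l ab_gt0).
apply: le_trans (_ : (a + b) * (b * \sum_i x i ^+ 2 + a * \sum_i y i ^+ 2) <= _).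
  rewrite !mulr_sumr -big_split /= mulr_sumr; apply: ler_sum => i _.
  have := sqr_ge0 (b * x i - a * y i); nra.
have -> : a * b * ((a + b) ^+ 2 * N) = (a + b) * (b * (a ^+ 2 * N) + a * (b ^+ 2 * N)).
  by ring.
by rewrite ler_pM2l // lerD // ler_pM2l.
Qed.

Lemma sum_sqr_le_const (R : realFieldType) (n : nat) (x : 'I_n -> R) (c : R) :
  (forall i, - c <= x i <= c) -> \sum_i x i ^+ 2 <= c ^+ 2 * n%:R.
Proof.
move=> xc; apply: le_trans (_ : \sum_(i < n) c ^+ 2 <= _).
  by apply: ler_sum => i _; have := xc i; nra.
by rewrite sumr_const card_ord mulr_natr.
Qed.

(** The distances force the inner product of [a] and [b] to be [k], the equality case of
    Cauchy-Schwarz; expanding the squared norm of [b - k a] then gives 0. *)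
Lemma collinear_of_dists (R : realFieldType) (I : finType) (a b : I -> R) (k : R) :
  \sum_i a i ^+ 2 = 1 -> \sum_i b i ^+ 2 = k ^+ 2 ->
  \sum_i (b i - a i) ^+ 2 = (k - 1) ^+ 2 -> forall i, b i = k * a i.
Proof.
move=> a1 bk ba i.
have dot : \sum_i a i * b i = k.
  have : \sum_i (b i - a i) ^+ 2 = \sum_i b i ^+ 2 - 2 * \sum_i a i * b i + \sum_i a i ^+ 2.
    rewrite mulr_sumr -sumrB -big_split /=; apply: eq_bigr => j _; ring.
  rewrite ba bk a1; lra.
have z : \sum_i (b i - k * a i) ^+ 2 = 0.
  have -> : \sum_i (b i - k * a i) ^+ 2 =
      \sum_i b i ^+ 2 - 2 * k * \sum_i a i * b i + k ^+ 2 * \sum_i a i ^+ 2.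
    rewrite !mulr_sumr -sumrB -big_split /=; apply: eq_bigr => j _; ring.
  by rewrite dot a1 bk; ring.
have := psumr_eq0P (fun j _ => sqr_ge0 (b j - k * a j)) z (i := i) isT.
by move/eqP; rewrite sqrf_eq0 subr_eq0 => /eqP.
Qed.

Lemma edist_sqr (R : realType) (n : nat) (x y : 'rV[R]_n) :
  edist x y ^+ 2 = \sum_(i < n) (x ord0 i - y ord0 i) ^+ 2.
Proof. by rewrite /edist sqr_sqrtr // sumr_ge0 // => i _; apply: sqr_ge0. Qed.

Lemma edist_const_sqr (R : realType) (a b : R) :
  edist (const_mx a : 'rV[R]_1) (const_mx b) ^+ 2 = (a - b) ^+ 2.
Proof. by rewrite edist_sqr big_ord1 !mxE. Qed.

(** The images of 0 and 1 fix the direction; the distances of any other image to these two place it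
    on their line. *)
Lemma isometric_ell_line (R : realType) (n m : nat) (f : 'rV[R]_1 -> 'rV[R]_n) :
  (2 <= m)%N ->
  (forall x y, ell R m x -> ell R m y -> edist (f x) (f y) = edist x y) ->
  exists2 u : 'I_n -> R, \sum_j u j ^+ 2 = 1 &
    forall k j, (k < m)%N ->
      f (const_mx k%:R) ord0 j = f (const_mx 0%:R) ord0 j + k%:R * u j.
Proof.
move=> m2 iso.
have d k l : (k < m)%N -> (l < m)%N ->
    \sum_j (f (const_mx k%:R) ord0 j - f (const_mx l%:R) ord0 j) ^+ 2
      = (k%:R - l%:R) ^+ 2.
  move=> km lm; rewrite -edist_sqr iso ?edist_const_sqr //; [by exists k|by exists l].
exists (fun j => f (const_mx 1%:R) ord0 j - f (const_mx 0%:R) ord0 j).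
  by rewrite d ?(ltnW m2) // subr0 expr1n.
move=> k j km.
rewrite -[LHS](subrK (f (const_mx 0%:R) ord0 j)) addrC; congr (_ + _).
have m0 := ltnW m2.
apply: (collinear_of_dists (a := fun j => f (const_mx 1%:R) ord0 j - f (const_mx 0%:R) ord0 j)
  (b := fun j => f (const_mx k%:R) ord0 j - f (const_mx 0%:R) ord0 j)).
- by rewrite d // subr0 expr1n.
- by rewrite d // subr0.
- rewrite -(d k 1%N) //; apply: eq_bigr => i _; ring.
Qed.

Lemma intr_sqnorm (R : realFieldType) (n : nat) (z : 'I_n -> int) :
  (sqnorm z)%:~R = \sum_j (z j)%:~R ^+ 2 :> R.
Proof. by rewrite /sqnorm rmorph_sum; apply: eq_bigr => j _; rewrite rmorphXn. Qed.

(** Rounding [t w], then [l b / t], costs at most 1 each per coordinate. True displacements between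
    distinct indices have norm at least [35 sqrt n], the errors change them by at most [2 sqrt n],
    and [35 - 2 > 26]. *)
Lemma discretized_line (R : realType) (n t : nat) (w : 'I_n -> R)
    (b := fun j => Num.floor (t%:R * w j)) :
  (0 < n)%N -> (0 < t)%N -> \sum_j w j ^+ 2 = 35 ^+ 2 * n%:R ->
  [/\ forall j, (`|b j| <= 35 * t * n)%N,
      forall (l : 'I_t) j, 0 <= l%:R * w j - (l%:Z * b j %/ t)%Z%:~R <= 2 &
      forall l l' : 'I_t, (l < l')%N ->
        (676 * n)%:Z < sqnorm (fun j => (l'%:Z * b j %/ t)%Z - (l%:Z * b j %/ t)%Z)].
Proof.
move=> n_gt0 t_gt0 wn.
have n1 : 1 <= n%:R :> R by rewrite ler1n.
have t1 : 1 <= t%:R :> R by rewrite ler1n.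
have err (l : 'I_t) j : 0 <= l%:R * w j - (l%:Z * b j %/ t)%Z%:~R <= 2.
  have := divz_eq (l%:Z * b j) t; have := ltz_pmod (l%:Z * b j) (d := t).
  have := modz_ge0 (l%:Z * b j) (d := t).
  move: (_ %/ _)%Z (_ %% _)%Z => q r r_ge r_lt e.
  have {}r_lt : r + 1 <= t by suff : r < t; [lia | apply: r_lt; lia].
  have {}r_ge : 0 <= r by apply: r_ge; lia.
  have /andP[] := floor_itv (t%:R * w j); rewrite -/(b j) intrD.
  move: e; move/(congr1 (intr : int -> R)); rewrite intrD !intrM -!pmulrn.
  move: r_lt r_ge; rewrite -(ler_int R) -(ler_int R 0) intrD -!pmulrn.
  have : (l%:R + 1 : R) <= t%:R by rewrite natr1 ler_nat.
  have : 0 <= l%:R :> R by [].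
  move: (l%:R) (t%:R : R) t1 (w j) (q%:~R) (r%:~R) ((b j)%:~R) => L T T1 W Q r' B.
  move=> L0 LT r1 r0 e bl bu.
  (* Cleared of the denominator [T], the error splits into [L (T W - B)], from the direction, and
     the remainder [r'], both in [[0, T]]. *)
  have h : 0 <= T * (L * W - Q) <= 2 * T.
    have -> : T * (L * W - Q) = L * (T * W - B) + r' by lra.
    by apply/andP; split; nra.
  by move/andP: h => [h1 h2]; apply/andP; split; nra.
split=> //.
- move=> j.
  have wj : w j ^+ 2 <= (35 * n%:R) ^+ 2.
    apply: le_trans (_ : 35 ^+ 2 * n%:R <= _); last by nra.
    by rewrite -wn (bigD1 j) //= lerDl sumr_ge0 // => i _; apply: sqr_ge0.
  have /andP[w1 w2] : - (35 * n%:R) <= w j <= 35 * n%:R by apply/andP; split; nra.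
  have : - (35 * t * n)%:Z <= b j <= (35 * t * n)%:Z.
    rewrite /b floor_ge_int; apply/andP; split.
      by rewrite mulrNz -pmulrn !natrM; nra.
    rewrite -(ler_int R); apply: le_trans (floor_le _) _.
    by rewrite -pmulrn !natrM; nra.
  lia.
- move=> l l' ll'; rewrite ltNge; apply/negP; rewrite -(ler_int R) intr_sqnorm => small.
  pose e (l : 'I_t) j := l%:R * w j - (l%:Z * b j %/ t)%Z%:~R.
  have sum_e : \sum_j (e l' j - e l j) ^+ 2 <= 2 ^+ 2 * n%:R.
    apply: sum_sqr_le_const => j; have := err l j; have := err l' j; rewrite -/(e _ _) -/(e _ _).
    lra.
  have c676 : (676 * n)%:Z%:~R = 26 ^+ 2 * n%:R :> R by rewrite -pmulrn natrM; ring.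
  rewrite c676 in small.
  have := sum_sqrD_le (ltr0n R 26) (ltr0n R 2) small sum_e.
  rewrite (eq_bigr (fun j => ((l' - l)%N%:R) ^+ 2 * w j ^+ 2)) => [|j _]; last first.
    by rewrite /e intrB natrB ?(ltnW ll') //; ring.
  rewrite -mulr_sumr wn.
  have : 1 <= (l' - l)%N%:R :> R by rewrite ler1n subn_gt0.
  move: (l' - l)%N%:R => D D1.
  have : 1 <= D ^+ 2 by nra.
  nra.
Qed.

(** * The coloring by balls around a sparse lattice set *)

Section Coloring.

Variables (R : realType) (n : nat) (S : ('I_n -> int) -> Prop).

Definition scale : R := 7 * Num.sqrt n%:R.

Definition lattice_red (x : 'rV[R]_n) : Prop :=
  exists2 z : 'I_n -> int, S z &
    \sum_j (scale * x ord0 j - (z j)%:~R) ^+ 2 <= 3 ^+ 2 * n%:R.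

Lemma scale_sqr : scale ^+ 2 = 7 ^+ 2 * n%:R.
Proof. by rewrite /scale exprMn sqr_sqrtr. Qed.

(** At unit distance the centres are at most [(3 + 7 + 3) sqrt n] apart, hence equal; but then the
    dilated points are at most [6 sqrt n] apart, less than [7 sqrt n]. *)
Lemma lattice_red_no_unit (x y : 'rV[R]_n) : (0 < n)%N ->
  (forall z w, S z -> S w -> sqnorm (fun j => w j - z j) <= (169 * n)%:Z -> z = w) ->
  lattice_red x -> lattice_red y -> edist x y <> 1.
Proof.
move=> n_gt0 sparse [z Sz xz] [w Sw yw] xy1.
have n0 : 0 < n%:R :> R by rewrite ltr0n.
have xy : \sum_j (scale * x ord0 j - scale * y ord0 j) ^+ 2 = 7 ^+ 2 * n%:R.
  rewrite -scale_sqr -[RHS]mulr1 -(expr1n R 2) -xy1 edist_sqr mulr_sumr.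
  by apply: eq_bigr => j _; ring.
have xy_le : \sum_j (scale * x ord0 j - scale * y ord0 j) ^+ 2 <= 7 ^+ 2 * n%:R by rewrite xy.
have zx : \sum_j ((z j)%:~R - scale * x ord0 j) ^+ 2 <= 3 ^+ 2 * n%:R.
  by apply: le_trans xz; rewrite le_eqVlt; apply/orP; left; apply/eqP/eq_bigr => j _; ring.
have zw : z = w.
  apply: sparse => //; rewrite -(ler_int R) intr_sqnorm.
  have h := sum_sqrD_le (ltr0n R 3) (ltr0n R 7) zx xy_le.
  have := sum_sqrD_le (_ : 0 < 3 + 7) (ltr0n R 3) h yw.
  rewrite -pmulrn natrM => h'.
  apply: le_trans (_ : (3 + 7 + 3) ^+ 2 * n%:R <= _); last by nra.
  apply: le_trans (h' _); last by lra.
  rewrite le_eqVlt; apply/orP; left; apply/eqP/eq_bigr => j _; rewrite intrB; ring.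
rewrite -zw in yw.
have zy : \sum_j ((z j)%:~R - scale * y ord0 j) ^+ 2 <= 3 ^+ 2 * n%:R.
  by apply: le_trans yw; rewrite le_eqVlt; apply/orP; left; apply/eqP/eq_bigr => j _; ring.
have := sum_sqrD_le (ltr0n R 3) (ltr0n R 3) xz zy.
rewrite (eq_bigr (fun j => (scale * x ord0 j - scale * y ord0 j) ^+ 2)); last first.
  by move=> j _; ring.
rewrite xy; nra.
Qed.

Lemma lattice_red_hits_line (t : nat) (f : 'rV[R]_1 -> 'rV[R]_n) :
  (0 < n)%N -> (0 < t)%N ->
  (forall a b : 'I_n -> int, (forall j, `|b j| <= 35 * t * n)%N ->
     (forall l l' : 'I_t, (l < l')%N ->
        (676 * n)%:Z < sqnorm (fun j => (l'%:Z * b j %/ t)%Z - (l%:Z * b j %/ t)%Z)) ->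
     exists l : 'I_t, S (fun j => a j + (l%:Z * b j %/ t)%Z)) ->
  (forall x y, ell R (5 * t) x -> ell R (5 * t) y -> edist (f x) (f y) = edist x y) ->
  exists2 x, ell R (5 * t) x & lattice_red (f x).
Proof.
move=> n_gt0 t_gt0 hit iso.
have [|u u1 line] := isometric_ell_line _ iso; first by lia.
(* Five unit steps after dilation, of norm [5 * 7 sqrt n = 35 sqrt n]. *)
pose w j := 5 * scale * u j.
have wn : \sum_j w j ^+ 2 = 35 ^+ 2 * n%:R.
  rewrite (eq_bigr (fun j => 5 ^+ 2 * scale ^+ 2 * u j ^+ 2)).
    by rewrite -mulr_sumr u1 scale_sqr; ring.
  by move=> j _; rewrite /w; ring.
have [bn err sep] := discretized_line n_gt0 t_gt0 wn.
pose p0 := f (const_mx 0%:R).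
have [l Sl] := hit (fun j => Num.floor (scale * p0 ord0 j)) _ bn sep.
exists (const_mx (5 * l)%:R); first by exists (5 * l)%N => //; have := ltn_ord l; lia.
eexists; first exact: Sl.
(* Per coordinate, rounding the base point errs within [[0, 1]] and rounding the line within
   [[0, 2]], so the total stays within radius [3 sqrt n]. *)
apply: sum_sqr_le_const => j; rewrite line; last by have := ltn_ord l; lia.
have := err l j; have := floor_itv (scale * p0 ord0 j).
rewrite !intrD natrM /w -/p0; lra.
Qed.

End Coloring.

Theorem mainTheorem2 (R : realType) (n : nat) (hn : (1 <= n)%N) :
  not_arrow n (ell R 2) (ell R (10 ^ (5 * n))).
Proof.
case: n hn => // p _.
have mE : (10 ^ (5 * p.+1) = 5 * (2 * 10 ^ (5 * p + 4)))%N.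
  by rewrite (_ : 5 * p.+1 = (5 * p + 4).+1)%N ?expnS; lia.
have [S [sparse hit]] := sparse_lattice_set (erefl (2 * 10 ^ (5 * p + 4))%N).
exists (fun x => if `[< lattice_red (R := R) S x >] then Red else Blue); split.
- case=> A [[f [iso ->]] mono].
  have ell0 : ell R 2 (const_mx 0%:R) by exists 0%N.
  have ell1 : ell R 2 (const_mx 1%:R) by exists 1%N.
  have red x : ell R 2 x -> lattice_red S (f x).
    move=> x2; apply: contrapT => /asboolPn nred.
    by have := mono (f x) (ex_intro2 _ _ x x2 erefl); rewrite (negPf nred).
  apply: (lattice_red_no_unit (n := p.+1) _ sparse (red _ ell1) (red _ ell0)) => //.
  rewrite iso // -[LHS]ger0_norm ?sqrtr_ge0 // -sqrtr_sqr edist_const_sqr.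
  by rewrite subr0 expr1n sqrtr1.
- rewrite mE; case=> A [[f [iso ->]] mono].
  have [||x xl red] := lattice_red_hits_line _ _ hit iso => //.
    by rewrite muln_gt0 expn_gt0.
  have := mono (f x) (ex_intro2 _ _ x xl erefl).
  by have -> : `[< lattice_red S (f x) >] by exact/asboolP.
Qed.
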